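(* Let $P$ be the Borel probability measure on $\mathbb{R}$ with $P(\{k\})=2^{-k}$ for every $k\in\mathbb{N}=\{1,2,3,\dots\}$. The optimal set of two-means for $P$ is $\{Av[1,2],Av[3,\infty)\}$, with quantization error $V_2(P)=\frac23$.
   Context: For a Borel probability measure $P$ on $\mathbb{R}$ and a nonempty finite set $\alpha\subset\mathbb{R}$, the distortion error is $V(P;\alpha)=\int\min_{a\in\alpha}|x-a|^2\,dP(x)$. The $n$th quantization error is $V_n(P)=\inf\{V(P;\alpha):\alpha\subset\mathbb{R},\ 1\le\mathrm{card}(\alpha)\le n\}$, and a set $\alpha$ with $1\le\mathrm{card}(\alpha)\le n$ attaining this infimum is called an optimal set of $n$-means for $P$. For integers $1\le k\le\ell$ put $Av[k,\ell]=\dfrac{\sum_{j=k}^{\ell}j2^{-j}}{\sum_{j=k}^{\ell}2^{-j}}$ and $Av[k,\infty)=\dfrac{\sum_{j=k}^{\infty}j2^{-j}}{\sum_{j=k}^{\infty}2^{-j}}$. *)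

(* Defs.v *)
From HB Require Import structures.
From mathcomp Require Import all_boot all_order all_algebra finmap.
From mathcomp Require Import all_classical all_reals all_analysis.

Set Implicit Arguments.
Unset Strict Implicit.
Unset Printing Implicit Defensive.

Import Order.TTheory GRing.Theory Num.Theory.
Import numFieldNormedType.Exports.

Local Open Scope classical_set_scope.
Local Open Scope ring_scope.
Local Open Scope fset_scope.

Section Quantization.
Context {R : realType}.
Implicit Types (P : probability (measurableTypeR R) R) (alpha : {fset R}).

(* The minimum is taken in \bar R with neutral element +oo, so on a nonempty
   alpha it is the minimum of the squared distances. *)
Definition distortion P alpha : \bar R :=
  (\int[P]_x \big[mine/+oo]_(a <- alpha) ((`|x - a| ^+ 2)%:E))%E.

Definition quantization_error (n : nat) P : \bar R :=
  ereal_inf [set distortion P alpha | alpha in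
    [set alpha : {fset R} | (1 <= #|` alpha| <= n)%N]].

Definition optimal_nmeans (n : nat) P alpha : Prop :=
  (1 <= #|` alpha| <= n)%N /\ distortion P alpha = quantization_error n P.

End Quantization.

Definition Av (R : realType) (k l : nat) : R :=
  (\sum_(k <= j < l.+1) j%:R * 2 ^- j) / (\sum_(k <= j < l.+1) 2 ^- j).

Definition Av_infty (R : realType) (k : nat) : R :=
  (\big[+%R/0]_(k <= j <oo) (j%:R * 2 ^- j : R)) /
  (\big[+%R/0]_(k <= j <oo) (2 ^- j : R)).

(* Main.v *)
(* A set of at most two means has the form {a <= b}, and its cost depends on
   which atoms lie to the left of the midpoint (a+b)/2.  If that midpoint is at
   least m and less than m+1, the atoms beyond m cost
   2^-m (2 + (b-m-2)^2), by memorylessness of the geometric law (mean 2,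
   variance 2).  This alone exceeds 2/3 for m <= 1; for m = 2 the total is
   2/3 + 3/4 (a - 4/3)^2 + 1/4 (b - 4)^2; for m = 3 it is at least
   13/28 + 1/4; for m >= 4 the first four atoms already cost at least 97/120. *)

Require Import Defs.
From HB Require Import structures.
From mathcomp Require Import all_boot all_order all_algebra finmap.
From mathcomp Require Import all_classical all_reals all_analysis.
From mathcomp Require Import measurable_realfun.
From mathcomp Require Import ring lra zify.

Set Implicit Arguments.
Unset Strict Implicit.
Unset Printing Implicit Defensive.

Import Order.TTheory GRing.Theory Num.Theory.
Import numFieldNormedType.Exports.

Local Open Scope classical_set_scope.
Local Open Scope fset_scope.
Local Open Scope ring_scope.

(** * Summing a quadratic polynomial against [2 ^- n] *)

Section QuadGeomSeries.
Variable R : realType.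
Implicit Types c : R.

Definition quad_geom c0 c1 c2 (n : nat) : R :=
  (c0 + c1 * n%:R + c2 * n%:R ^+ 2) * 2 ^- n.

(* The sum of [quad_geom c0 c1 c2 j] over [j >= n]. *)
Definition quad_geom_tail c0 c1 c2 (n : nat) : R :=
  2 * (c0 + c1 * (n%:R + 1) + c2 * (n%:R ^+ 2 + 2 * n%:R + 3)) * 2 ^- n.

(** [quad_geom_tail] is a discrete antiderivative: its decrement from [j] to [j.+1] is [quad_geom]
    at [j]. *)
Lemma sum_quad_geom c0 c1 c2 k n : (k <= n)%N ->
  \sum_(k <= j < n) quad_geom c0 c1 c2 j =
  quad_geom_tail c0 c1 c2 k - quad_geom_tail c0 c1 c2 n.
Proof.
move=> kn; rewrite -[RHS]opprB -(telescope_sumr _ kn) -sumrN.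
apply: eq_bigr => j _.
rewrite /quad_geom /quad_geom_tail opprB [2 ^+ j.+1]exprS invfM.
by rewrite -(natr1 j); field; rewrite expf_neq0.
Qed.

(** One degree more than the quadratic factor of the tail leaves a spare [1 / (n + 1)]. The constant
    8 is forced by equality at [n = 3]. *)
Lemma cube_le_expn2 n : (n.+1 ^ 3 <= 8 * 2 ^ n)%N.
Proof.
case: (ltnP n 4) => [|n4]; first by case: n => [|[|[|[|]]]].
elim: n n4 => // n IH; rewrite leq_eqVlt => /predU1P[<-//|].
rewrite ltnS => n4; have {IH} := IH n4.
rewrite (expnS 2 n) !expnS expn0 !muln1; move: (2 ^ n)%N => p; nia.
Qed.

Lemma cvg_quad_geom_tail c0 c1 c2 :
  quad_geom_tail c0 c1 c2 n @[n --> \oo] --> (0 : R).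
Proof.
(* With [x = n + 1 >= 1] and [A = C / 16], the quadratic factor is at most [A x^2]; then
   [x^3 <= 8 * 2^n] bounds the tail by [16 A / x]. *)
pose C : R := 16 * (`|c0| + `|c1| + 3 * `|c2|).
have C0 : 0 <= C by rewrite mulr_ge0// !addr_ge0// mulr_ge0.
apply/norm_cvg0P.
apply: (@squeeze_cvgr _ _ _ _ (fun=> 0) (fun n => C * @harmonic R n));
  last 2 first.
- exact: cvg_cst.
- rewrite -(mulr0 C); apply: cvgMl_tmp; exact: cvg_harmonic.
near=> n; rewrite normr_ge0 /= /quad_geom_tail.
have := cube_le_expn2 n; rewrite -(ler_nat R) natrX natrM natrX -(natr1 n).
set p : R := 2 ^+ n; set x : R := n%:R + 1 => cube.
have p0 : 0 < p by rewrite exprn_gt0.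
have x1 : 1 <= x by rewrite lerDr.
have x0 : 0 < x by exact: lt_le_trans x1.
have le_quad : `|c0 + c1 * x + c2 * (n%:R ^+ 2 + 2 * n%:R + 3)| <=
    (`|c0| + `|c1| + 3 * `|c2|) * x ^+ 2.
  have -> : n%:R ^+ 2 + 2 * n%:R + 3 = x ^+ 2 + 2 :> R by rewrite /x; ring.
  apply: le_trans (ler_normD _ _) _; rewrite mulrDl; apply: lerD; last first.
    have x2 : 0 <= x ^+ 2 + 2 by rewrite addr_ge0// sqr_ge0.
    by rewrite normrM (ger0_norm x2) (mulrC 3 `|c2|) -mulrA ler_wpM2l//; nra.
  apply: le_trans (ler_normD _ _) _; rewrite mulrDl normrM (gtr0_norm x0).
  by apply: lerD; [rewrite ler_peMr// expr_ge1// ltW|rewrite ler_wpM2l//; nra].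
rewrite normrM normrM (ger0_norm (_ : 0 <= 2))// normfV (gtr0_norm p0).
rewrite ler_pdivrMr// mulrAC ler_pdivlMr// /C.
have := normr_ge0 c0; have := normr_ge0 c1; have := normr_ge0 c2.
move: le_quad; set A := _ + _ + 3 * _; set q := `|_ + _ + _| => le_quad *.
have A0 : 0 <= A by rewrite /A; lra.
have : A * x ^+ 3 <= A * (8 * p) by exact: ler_wpM2l.
have : q * x <= A * x ^+ 2 * x by rewrite ler_pM2r.
rewrite -mulrA -exprSr; lra.
Unshelve. all: end_near. Qed.

Lemma cvg_sum_quad_geom c0 c1 c2 k :
  \sum_(k <= j < n) quad_geom c0 c1 c2 j @[n --> \oo] -->
  quad_geom_tail c0 c1 c2 k.
Proof.
rewrite -[X in _ --> X]subr0.
apply: (cvg_trans _ (cvgB (cvg_cst _) (cvg_quad_geom_tail c0 c1 c2))).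
apply: near_eq_cvg; near=> n; rewrite /= sum_quad_geom//.
by near: n; exact: nbhs_infty_ge.
Unshelve. all: end_near. Qed.

Lemma nneseries_quad_geom c0 c1 c2 k :
  \big[+%E/0%E]_(k <= j <oo) (quad_geom c0 c1 c2 j)%:E =
  (quad_geom_tail c0 c1 c2 k)%:E.
Proof.
apply: cvg_lim => //.
rewrite (_ : (fun n => _) =
    EFin \o (fun n => \sum_(k <= j < n) quad_geom c0 c1 c2 j)).
  by apply: cvg_EFin; [exact: nearW|exact: cvg_sum_quad_geom].
by apply/funext => n; rewrite /= sumEFin.
Qed.
End QuadGeomSeries.

(** * Values of the two means *)

Lemma Av12 (R : realType) : Av R 1 2 = 4 / 3.
Proof.
by rewrite /Av !(@big_ltn _ _ _ 1)// !(@big_ltn _ _ _ 2)// !big_geq//; field.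
Qed.

Lemma Av_infty3 (R : realType) : Av_infty R 3 = 4.
Proof.
rewrite /Av_infty.
have -> : (fun n => \sum_(3 <= j < n) (j%:R * 2 ^- j : R)) =
    (fun n => \sum_(3 <= j < n) quad_geom 0 1 0 j).
  by apply/funext => n; apply: eq_bigr => j _; rewrite /quad_geom; ring.
have -> : (fun n => \sum_(3 <= j < n) (2 ^- j : R)) =
    (fun n => \sum_(3 <= j < n) quad_geom 1 0 0 j).
  by apply/funext => n; apply: eq_bigr => j _; rewrite /quad_geom; ring.
rewrite (cvg_lim _ (@cvg_sum_quad_geom R 0 1 0 3))//.
rewrite (cvg_lim _ (@cvg_sum_quad_geom R 1 0 0 3))//.
by rewrite /quad_geom_tail; field.
Qed.

(* The atom with index [i] sits at [i.+1] and has mass [2 ^- i.+1]. *)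
Definition geometric_cost (R : realType) (a b : R) (i : nat) : R :=
  Num.min ((i.+1%:R - a) ^+ 2) ((i.+1%:R - b) ^+ 2) * 2 ^- i.+1.

Lemma geometric_cost_ge0 (R : realType) (a b : R) i : 0 <= geometric_cost a b i.
Proof. by rewrite mulr_ge0// le_min !sqr_ge0. Qed.

(** * Distortion of the geometric law as a series *)

Section Geometric.
Variables (R : realType) (P : probability (measurableTypeR R) R).
Hypothesis hP : forall k : nat, (1 <= k)%N ->
  P [set (k%:R : R)]%classic = (2 ^- k)%:E.

Let F (i : nat) : set (measurableTypeR R) := [set (i.+1%:R : R)]%classic.

Let mF i : measurable (F i).
Proof. exact: measurable_set1. Qed.

Let trivF : trivIset setT F.
Proof.
by move=> i j _ _ [x [-> /= /eqP]]; rewrite eqr_nat => /eqP[].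
Qed.

(** The masses of the disjoint atoms already sum to 1. *)
Lemma geometric_null : P (~` \bigcup_i F i)%classic = 0%E.
Proof.
rewrite probability_setC; last exact: bigcup_measurable.
rewrite measure_bigcup//.
rewrite (eq_eseriesl _ _ (Q := xpredT)); last by move=> i; rewrite in_setT.
rewrite (eq_eseriesr (g := fun i => (quad_geom 2^-1 0 0 i)%:E)).
  by rewrite nneseries_quad_geom -EFinB /quad_geom_tail; congr EFin; field.
move=> i _; rewrite [LHS](hP (ltn0Sn i)) /quad_geom; congr EFin; rewrite exprS.
by field; rewrite expf_neq0.
Qed.

(** The integral restricts to the union of the atoms, whose complement is null, and [f] is constant
    on each atom. *)
Lemma geometric_integral (f : measurableTypeR R -> \bar R) :
  measurable_fun [set: measurableTypeR R] f -> (forall x, 0 <= f x)%E ->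
  (\int[P]_x f x = \big[+%E/0]_(0 <= i <oo) (f i.+1%:R * (2 ^- i.+1)%:E))%E.
Proof.
move=> mf f0.
rewrite (ge0_negligible_integral _ _ mf _ geometric_null)//; last first.
  by apply: measurableC; exact: bigcup_measurable.
rewrite setDE setCK setTI ge0_integral_bigcup//; last first.
  exact: measurable_funS mf.
apply: eq_eseriesr => i _.
rewrite -hP// -integral_cst//.
by apply: eq_integral => x; rewrite inE => ->.
Qed.

Lemma distortion_geometric (a b : R) :
  distortion P [fset a; b] = (\big[+%E/0]_(0 <= i <oo)
    (geometric_cost a b i)%:E)%E.
Proof.
rewrite /distortion.
have E (x : R) : (\big[mine/+oo]_(c <- [fset a; b]) ((`|x - c| ^+ 2)%:E))%E =
    (Num.min ((x - a) ^+ 2) ((x - b) ^+ 2))%:E.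
  (* If [a = b], the set is a singleton and the minimum has one term only. *)
  have [<-|ab] := eqVneq a b.
    by rewrite fsetUid big_seq_fset1 minxx real_normK// num_real.
  by rewrite big_fsetU1 ?inE// big_seq_fset1 !real_normK ?num_real// EFin_min.
under eq_integral do rewrite E.
rewrite geometric_integral//; last first.
  by move=> x; rewrite lee_fin le_min !sqr_ge0.
apply/measurable_EFinP/measurable_minr.
- by apply: measurable_funX; apply: measurable_funB.
- by apply: measurable_funX; apply: measurable_funB.
Qed.

Lemma le_distortion_geometric (a b : R) m :
  ((\sum_(0 <= i < m) geometric_cost a b i)%:E <= distortion P [fset a; b])%E.
Proof.
rewrite distortion_geometric -sumEFin.
by apply: nneseries_lim_ge => i _ _; rewrite lee_fin geometric_cost_ge0.
Qed.

(* The hypotheses say that every atom beyond [m] is served by [b]. *)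
Lemma distortion_geometric_split (a b : R) m : a <= b -> a + b <= 2 * m.+1%:R ->
  distortion P [fset a; b] = (\sum_(0 <= i < m) geometric_cost a b i +
    (2 + (b - m%:R - 2) ^+ 2) * 2 ^- m)%:E.
Proof.
move=> ab abm.
rewrite distortion_geometric (nneseries_split 0 m); last first.
  by move=> i _; rewrite lee_fin geometric_cost_ge0.
rewrite add0n sumEFin EFinD; congr (_ + _)%E.
(* Constant coefficient of [(j + 1 - b)^2 / 2] as a polynomial in [j]. *)
pose c0 : R := (1 - b) ^+ 2 / 2.
transitivity (\big[+%E/0%E]_(m <= j <oo) (quad_geom c0 (1 - b) 2^-1 j)%:E).
  rewrite eseries_cond [RHS]eseries_cond.
  apply: eq_eseriesr => i /= mi; rewrite /geometric_cost min_r; last first.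
    have : m.+1%:R <= i.+1%:R :> R by rewrite ler_nat.
    by move: (i.+1%:R) => x mx; nra.
  rewrite /quad_geom /c0 -natr1 [2 ^+ i.+1]exprS; congr EFin.
  by field; rewrite expf_neq0.
rewrite nneseries_quad_geom /quad_geom_tail /c0; congr EFin.
by field; rewrite expf_neq0.
Qed.

Lemma distortion_geometric_min (a b : R) : a <= b ->
  ((2 / 3)%:E <= distortion P [fset a; b])%E /\
  (distortion P [fset a; b] = (2 / 3)%:E -> a = 4 / 3 /\ b = 4).
Proof.
move=> ab.
(* A lower bound strictly above 2/3 settles both claims, the second vacuously. *)
have small (r : R) : (r%:E <= distortion P [fset a; b])%E -> 2 / 3 < r ->
    ((2 / 3)%:E <= distortion P [fset a; b])%E /\
    (distortion P [fset a; b] = (2 / 3)%:E -> a = 4 / 3 /\ b = 4).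
  move=> rd r23; split; first by apply: le_trans rd; rewrite lee_fin ltW.
  by move=> E; move: rd; rewrite E lee_fin leNgt r23.
(* Splitting at [m = 1] covers midpoints below 1 too: [b] serves all atoms beyond 1, at cost at
   least 1. *)
have [c2|c2] := leP (a + b) 4.
  apply: (small 1); last by lra.
  rewrite (@distortion_geometric_split _ _ 1)// ?lee_fin; last by lra.
  rewrite big_nat1 expr1.
  have := geometric_cost_ge0 a b 0; have := sqr_ge0 (b - 1 - 2); lra.
have min1 : Num.min ((1 - a) ^+ 2) ((1 - b) ^+ 2) = (1 - a) ^+ 2.
  by apply: min_l; nra.
have min2 : Num.min ((2 - a) ^+ 2) ((2 - b) ^+ 2) = (2 - a) ^+ 2.
  by apply: min_l; nra.
have [c3|c3] := leP (a + b) 6.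
  have := @distortion_geometric_split a b 2 ab ltac:(lra).
  rewrite !big_nat_recr//= big_geq// /geometric_cost min1 min2.
  (* Completing squares: 3/4 and 1/4 are the masses of the atoms up to 2 and beyond 2, and 4/3 and 4
     their conditional means. *)
  have -> : 0 + (1 - a) ^+ 2 / 2 ^+ 1 + (2 - a) ^+ 2 / 2 ^+ 2 +
      (2 + (b - 2 - 2) ^+ 2) / 2 ^+ 2 =
    2 / 3 + (3 / 4 * (a - 4 / 3) ^+ 2 + 1 / 4 * (b - 4) ^+ 2) :> R by field.
  move=> ->; have := sqr_ge0 (a - 4 / 3); have := sqr_ge0 (b - 4) => hb ha; split.
    by rewrite lee_fin; lra.
  move=> [] E; have /eqP : (a - 4 / 3) ^+ 2 = 0 by lra.
  have /eqP : (b - 4) ^+ 2 = 0 by lra.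
  by rewrite !sqrf_eq0 !subr_eq0 => /eqP-> /eqP->.
have min3 : Num.min ((3 - a) ^+ 2) ((3 - b) ^+ 2) = (3 - a) ^+ 2.
  by apply: min_l; nra.
have [c4|c4] := leP (a + b) 8.
  apply: (small (5 / 7)); last by lra.
  rewrite (@distortion_geometric_split _ _ 3)// ?lee_fin; last by lra.
  rewrite !big_nat_recr//= big_geq// /geometric_cost min1 min2 min3.
  (* 11/7 is the conditional mean of the atoms 1, 2, 3, where their cost has its minimum 13/28;
     [5 / 7 = 13/28 + 1/4]. *)
  have := sqr_ge0 (a - 11 / 7); have := sqr_ge0 (b - 3 - 2).
  by rewrite !exprS expr0; lra.
have min4 : Num.min ((4 - a) ^+ 2) ((4 - b) ^+ 2) = (4 - a) ^+ 2.
  by apply: min_l; nra.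
(* 4/5 is a convenient value between 2/3 and 97/120; the latter is the cost of the atoms 1 to 4 at
   their conditional mean 26/15. *)
apply: (small (4 / 5)); last by lra.
apply: le_trans (le_distortion_geometric a b 4); rewrite lee_fin.
rewrite !big_nat_recr//= big_geq// /geometric_cost min1 min2 min3 min4.
have := sqr_ge0 (a - 26 / 15); rewrite !exprS expr0; lra.
Qed.
End Geometric.

(** A singleton is the case [a = b], so bounds for pairs [a <= b] cover every admissible set. *)
Lemma fset_le_two d (T : orderType d) (A : {fset T}) :
  (1 <= #|` A| <= 2)%N -> exists a b : T, (a <= b)%O /\ A = [fset a; b].
Proof.
move=> /andP[].
case: (fset_0Vmem A) => [->|[a aA] _]; first by rewrite cardfs0.
rewrite (cardfsD1 a) aA add1n ltnS leq_eqVlt ltnS leqn0 cardfs_eq0.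
case/orP => [/cardfs1P[b Eb]|/eqP E0].
  have E : A = [fset a; b] by rewrite -(fsetD1K aA) Eb.
  case: (leP a b) => ab; first by exists a, b.
  by exists b, a; rewrite ltW// fsetUC.
by exists a, a; split => //; rewrite -(fsetD1K aA) E0 fsetU0 fsetUid.
Qed.

Theorem proposition4p11 (R : realType)
    (P : probability (measurableTypeR R) R)
    (hP : forall k : nat, (1 <= k)%N -> P [set (k%:R : R)]%classic = (2 ^- k)%:E) :
  (forall alpha : {fset R},
     optimal_nmeans 2 P alpha <-> alpha = [fset Av R 1 2; Av_infty R 3]) /\
  quantization_error 2 P = (2 / 3)%:E.
Proof.
rewrite Av12 Av_infty3.
have card_opt : (1 <= #|` [fset (4 / 3 : R)%R; 4%R]| <= 2)%N.
  by rewrite cardfs2; case: (_ == _).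
have dist_opt : distortion P [fset (4 / 3)%R; 4%R] = (2 / 3)%:E.
  (* The split at [m = 2] applies because [4 / 3 + 4 <= 6]. *)
  rewrite (@distortion_geometric_split _ _ hP _ _ 2); [|lra..].
  rewrite !big_nat_recr//= big_geq// /geometric_cost !min_l; [|nra..].
  by congr EFin; field.
have qe : quantization_error 2 P = (2 / 3)%:E.
  apply/eqP; rewrite eq_le; apply/andP; split.
    by apply: ereal_inf_lbound; exists [fset (4 / 3)%R; 4%R].
  apply/ereal_infP => _ [alpha /fset_le_two[a [b [ab ->]]] <-].
  by have [] := distortion_geometric_min hP ab.
split=> // alpha; rewrite /optimal_nmeans qe; split; last by move=> ->.
move=> [/fset_le_two[a [b [ab ->]]] E].
by have [_ /(_ E)[-> ->]] := distortion_geometric_min hP ab.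
Qed.
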